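(* Let $\pi: G\to \mathscr{O}(\mathcal{H})$ be an ergodic orthogonal representation of a finitely generated amenable group $G$, and let $b: G\to \mathcal{H}$ be a $1$-cocycle associated to $\pi$. Let $S$ be a finite symmetric generating set for $G$, and let $|\cdot|$ denote the word length in $S$. If $(\mu_n)$ is a Reiter sequence for $G$, then $$\int \frac{1}{|g|}\, b(g)\, d\mu_n(g)\to 0$$ in the weak topology on $\mathcal{H}$. If $\pi$ is weakly mixing, then $$\int \frac{1}{|g|}\,|\langle b(g),\xi\rangle|\, d\mu_n(g)\to 0$$ for all $\xi\in\mathcal{H}$.
   Context: $G$ is a countable discrete group, $\mathcal{H}$ is a (real) Hilbert space, and $\mathscr{O}(\mathcal{H})$ is its orthogonal group. An orthogonal representation $\pi: G\to\mathscr{O}(\mathcal{H})$ is ergodic if it has no non-zero invariant vectors; it is weakly mixing if the diagonal representation $\pi\otimes\pi: G\to\mathscr{O}(\mathcal{H}\otimes\mathcal{H})$ is ergodic. A $1$-cocycle associated to $\pi$ is a map $b: G\to\mathcal{H}$ with $b(gh)=\pi_g(b(h))+b(g)$ for all $g,h\in G$. A Reiter sequence for $G$ is a sequence $(\mu_n)$ of regular Borel probability measures on $G$ such that $\|\mu_n-g\ast\mu_n\|\to 0$ (total variation, i.e. $\ell^1$, norm) for all $g\in G$, where $g\ast\mu_n(h)=\mu_n(g^{-1}h)$. $G$ is amenable if it admits a Reiter sequence. By convention, $\frac{1}{|e|}$ is understood to denote $0$ for $e$ the identity of $G$.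
   Formalization: The group G is assumed infinite; for finite G the claim fails whenever b is non-zero (e.g. G = Z/2 with the sign representation on the reals, b(s) = 1 and every μ_n uniform gives the constant value 1/2). *)

(* Defs.v *)
From HB Require Import structures.
From mathcomp Require Import all_boot all_order all_algebra.
From mathcomp Require Import all_classical all_reals all_analysis.
From mathcomp Require Import monoid sesquilinear finmap.
From mathcomp.analysis.showcase Require summability.

Set Implicit Arguments.
Unset Strict Implicit.
Unset Printing Implicit Defensive.
Import Order.TTheory GRing.Theory Num.Theory.
Import numFieldNormedType.Exports.
Local Open Scope classical_set_scope.
Local Open Scope ring_scope.

HB.mixin Record CompleteNormedModule_isHilbert (R : realType) H
    & CompleteNormedModule R H := {
  inner : {dot H for idfun} ;
  inner_normE : forall x : H, inner x x = `|x| ^+ 2 }.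

#[short(type="hilbertType")]
HB.structure Definition Hilbert (R : realType) :=
  {H of CompleteNormedModule_isHilbert R H & CompleteNormedModule R H}.

Notation "''[' x , y ]" := (inner x y) (format "''[' x ,  y ]") : ring_scope.

(* The coarsest topology on H for which every norm-continuous linear functional
   on H is continuous. *)
Definition weak (R : realType) (H : hilbertType R) : Type :=
  sup_topology (fun f : {f : {linear H -> R^o} | continuous f} =>
    Topological.class (initial_topology (sval f : H -> R^o))).

HB.instance Definition _ (R : realType) (H : hilbertType R) :=
  Topological.on (weak H).

(* H1 (x) H2 is determined, up to a unique isometric isomorphism compatible with
   the elementary tensors, by: the inner product is multiplicative on elementary
   tensors, and the finite sums of elementary tensors (which include their linear
   combinations) are dense. *)
Definition hilbert_tensor (R : realType) (H1 H2 K : hilbertType R)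
    (tau : {bilinear H1 -> H2 -> K}) : Prop :=
  (forall x x' y y', '[tau x y, tau x' y'] = '[x, x'] * '[y, y']) /\
  dense [set \sum_(p <- s) tau p.1 p.2 | s in [set: seq (H1 * H2)]].

Definition orthogonal_operator (R : realType) (H : hilbertType R)
    (T : H -> H) : Prop :=
  [/\ linear T, bijective T & forall x y, '[T x, T y] = '[x, y]].

Definition orthogonal_representation (R : realType) (G : groupType)
    (H : hilbertType R) (pi : G -> H -> H) : Prop :=
  (forall g, orthogonal_operator (pi g)) /\
  (forall g h, pi (g * h)%g = pi g \o pi h).

Definition ergodic (R : realType) (G : groupType) (H : hilbertType R)
    (pi : G -> H -> H) : Prop :=
  forall x, (forall g, pi g x = x) -> x = 0.

(* sigma is pi (x) pi acting on K = H (x) H; by the uniqueness of the Hilbert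
   tensor product the choice of (K, tau) is immaterial, and by density sigma is
   determined by pi. *)
Definition weakly_mixing (R : realType) (G : groupType) (H : hilbertType R)
    (pi : G -> H -> H) : Prop :=
  exists (K : hilbertType R) (tau : {bilinear H -> H -> K}) (sigma : G -> K -> K),
    [/\ hilbert_tensor tau,
        orthogonal_representation sigma,
        forall g x y, sigma g (tau x y) = tau (pi g x) (pi g y) &
        ergodic sigma].

Definition cocycle (R : realType) (G : groupType) (H : hilbertType R)
    (pi : G -> H -> H) (b : G -> H) : Prop :=
  forall g h, b (g * h)%g = pi g (b h) + b g.

Section words.
Variables (G : groupType) (S : {fset G}).

Definition symmetric_gen : Prop := forall s, s \in S -> (s^-1)%g \in S.

Definition generating : Prop :=
  forall A : set G, A 1%g -> (forall g h, A g -> A h -> A (g * h)%g) ->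
    (forall g, A g -> A (g^-1)%g) -> (forall s, s \in S -> A s) ->
  A = [set: G].

Definition is_word_length (g : G) (n : nat) : Prop :=
  exists w : seq G, [/\ size w = n, {in w, forall s, s \in S} &
                        (\prod_(s <- w) s)%g = g].

(* The default value 0 is never used when S is symmetric and generating. The
   identity has length 0 (empty word), and 0^-1 = 0 in a field, so that
   (word_length S g)%:R^-1 vanishes at g = 1. *)
Definition word_length (g : G) : nat :=
  if pselect (exists n, `[< is_word_length g n >]) is left e
  then ex_minn e else 0%N.

End words.

(* G with all its subsets measurable, i.e., with the Borel sigma-algebra of the
   discrete topology. *)
Definition discrete (G : groupType) : Type := G.

HB.instance Definition _ (G : groupType) := Choice.on (discrete G).
HB.instance Definition _ (G : groupType) :=
  isPointed.Build (discrete G) (1%g : G).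
HB.instance Definition _ (G : groupType) :=
  @isMeasurable.Build default_measure_display (discrete G) discrete_measurable
    discrete_measurable0 discrete_measurableC discrete_measurableU.

Section reiter.
Variables (R : realType) (G : groupType).

Definition reiter (mu : nat -> probability (discrete G) R) : Prop :=
  forall g : G,
    (\esum_(h in [set: G]) `|mu n [set h] - mu n [set (g^-1 * h)%g]|)%E
      @[n --> \oo] --> 0%E.

Definition amenable : Prop :=
  exists mu : nat -> probability (discrete G) R, reiter mu.

End reiter.

Section vector_integral.
Variables (R : realType) (G : groupType) (H : hilbertType R).

(* Bochner integral over a discrete space: f is integrable when |f| is, and its
   integral is then the sum of the mu{g} f(g), that is the limit in norm of the
   sums over the finite subsets of G ordered by inclusion. *)
Definition vintegrable (mu : probability (discrete G) R) (f : G -> H) : Prop :=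
  mu.-integrable [set: discrete G] (fun g => `|f g|%:E).

Definition vintegral (mu : probability (discrete G) R) (f : G -> H) : H :=
  summability.sum (fun g => fine (mu [set g]) *: f g).

End vector_integral.

(* Main.v *)
(* Let c(g) = b(g) / |g|. It is bounded, since |b(g)| <= L |g|, and almost
   equivariant: pi_h c(g) - c(hg) = O(1 / |g|) by the cocycle identity. A Reiter
   sequence on an infinite group gives vanishing mass to finite sets and is
   asymptotically invariant, so the functionals xi |-> \int <c, xi> dmu_n, which
   are uniformly bounded, tend to 0 at every xi - pi_h xi. The vectors at which
   they tend to 0 form a closed subspace, whose orthogonal complement consists of
   pi-invariant vectors; it is everything by ergodicity. When pi is weakly
   mixing, the same argument applied to c (x) c and pi (x) pi shows that
   \int <c, xi>^2 dmu_n tends to 0. *)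
Require Import Defs.
From HB Require Import structures.
From mathcomp Require Import all_boot all_order all_algebra.
From mathcomp Require Import all_classical all_reals all_analysis.
From mathcomp Require Import monoid sesquilinear finmap.
From mathcomp Require Import ring lra.

Set Implicit Arguments.
Unset Strict Implicit.
Unset Printing Implicit Defensive.
Import Order.TTheory GRing.Theory Num.Theory.
Import numFieldNormedType.Exports.
Local Open Scope classical_set_scope.
Local Open Scope ring_scope.

(** * Hilbert spaces *)

Section hilbert.
Variables (R : realType) (H : hilbertType R).
Implicit Types (x y z : H) (a : R).

Lemma innerC x y : '[x, y] = '[y, x].
Proof. by rewrite hermC /= expr0 mul1r. Qed.

Lemma innerDl x y z : '[x + y, z] = '[x, z] + '[y, z].
Proof. exact: linearDl. Qed.

Lemma innerDr x y z : '[x, y + z] = '[x, y] + '[x, z].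
Proof. exact: linearDr. Qed.

Lemma innerBl x y z : '[x - y, z] = '[x, z] - '[y, z].
Proof. exact: linearBl. Qed.

Lemma innerBr x y z : '[x, y - z] = '[x, y] - '[x, z].
Proof. exact: linearBr. Qed.

Lemma innerZl a x y : '[a *: x, y] = a * '[x, y].
Proof. exact: linearZl_LR. Qed.

Lemma innerZr a x y : '[x, a *: y] = a * '[x, y].
Proof. exact: linearZr_LR. Qed.

Lemma inner0r x : '[x, 0] = 0.
Proof. exact: linear0r. Qed.

Lemma sqr_normB x y : `|x - y| ^+ 2 = `|x| ^+ 2 - 2 * '[x, y] + `|y| ^+ 2.
Proof.
by rewrite -!inner_normE innerBl !innerBr (innerC y x); lra.
Qed.

Lemma parallelogram x y :
  `|x - y| ^+ 2 + `|x + y| ^+ 2 = 2 * `|x| ^+ 2 + 2 * `|y| ^+ 2.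
Proof.
rewrite sqr_normB -!inner_normE innerDl !innerDr (innerC y x); lra.
Qed.

(** Cauchy-Schwarz: subtracting from [x] its projection on the line of [y] leaves a vector of
    nonnegative squared norm, and multiplying that inequality by [|y|^2] gives the claim squared. *)
Lemma inner_le_norm x y : `|'[x, y]| <= `|x| * `|y|.
Proof.
have [->|y0] := eqVneq y 0; first by rewrite inner0r !normr0 mulr0.
have y0' : 0 < `|y| ^+ 2 by rewrite exprn_gt0// normr_gt0.
rewrite -ler_sqr ?nnegrE// ?mulr_ge0// real_normK ?num_real// exprMn.
have : 0 <= `|x - ('[x, y] / `|y| ^+ 2) *: y| ^+ 2 by rewrite exprn_ge0.
rewrite sqr_normB innerZr normrZ exprMn real_normK ?num_real//; set E := (X in 0 <= X).
move=> /(mulr_ge0 (ltW y0')); rewrite -subr_ge0; congr (0 <= _).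
by rewrite /E; field; rewrite normr_eq0.
Qed.

(** Projection theorem: a point [x] outside [M] has a nearest point [p] in [M], by the parallelogram
    law and completeness, and [x - p] is the required vector. *)
Lemma proper_closed_orthogonal (M : set H) :
  M 0 -> (forall a x y, M x -> M y -> M (a *: x + y)) -> closed M ->
  M != setT -> exists2 z, z != 0 & forall y, M y -> '[z, y] = 0.
Proof.
move=> M0 Mlin Mcl MT.
have [x Mx] : exists x, ~ M x.
  apply: contrapT => h; move/eqP : MT; apply; apply/seteqP; split=> // y _.
  by apply: contrapT => My; apply: h; exists y.
pose D := [set `|x - y| | y in M].
have D0 : D !=set0 by exists `|x - 0|, 0.
have Dlb : has_lbound D by exists 0 => _ [y _ <-].
pose d := inf D.
have dle y : M y -> d <= `|x - y| by move=> My; apply: ge_inf => //; exists y.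
have d0 : 0 <= d by apply: lb_le_inf => // _ [y _ <-].
(* The sets of almost nearest points generate a filter that replaces a minimizing sequence, so no
   choice is made. *)
pose A (e : R) := [set y | M y /\ `|x - y| < d + e].
pose F := filter_from [set e : R | 0 < e] A.
have FF : ProperFilter F.
  apply: filter_from_proper.
    apply: filter_from_filter; first by exists 1 => /=.
    move=> e e' /= e0 e'0; exists (Num.min e e'); first by rewrite /= lt_min e0.
    by move=> y [My]; rewrite -ltrBlDl lt_min !ltrBlDl => /andP[? ?]; split.
  move=> e /= e0; have [_ [y My <-]] := inf_adherent e0 (conj D0 Dlb).
  by exists y.
have Fc : cauchy F.
  apply: cauchy_exP => e e0.
  (* Two points of [M] within [d + r] of [x] have squared distance below
     [4 (d + r)^2 - 4 d^2 = 8 d r + 4 r^2], which is at most [(8 d + 4) r] since [r <= 1]. *)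
  pose r := Num.min 1 (e ^+ 2 / (8 * d + 4)).
  have d4 : 0 < 8 * d + 4 by lra.
  have r0 : 0 < r by rewrite lt_min ltr01 divr_gt0// exprn_gt0.
  have r1 : r <= 1 by rewrite ge_min lexx.
  have re : (8 * d + 4) * r <= e ^+ 2.
    by rewrite -ler_pdivlMl// mulrC ge_min lexx orbT.
  have [_ [y My <-] yr] := inf_adherent r0 (conj D0 Dlb).
  exists y, r => // y' [My' y'r]; rewrite -ball_normE /ball_ /=.
  rewrite -ltr_sqr ?nnegrE// ?(ltW e0)//.
  (* The midpoint of [y] and [y'] lies in [M], so it is at distance at least [d] from [x]. *)
  have mid : 2 * d <= `|(x - y') + (x - y)|.
    have Mm : M (2^-1 *: (y' + y)).
      by rewrite -[_ *: _]addr0; apply: (Mlin) => //; rewrite -[y']scale1r; exact: Mlin.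
    rewrite -ler_pdivlMl// -[X in _ <= X * _]gtr0_norm ?invr_gt0// -normrZ.
    have -> : 2^-1 *: ((x - y') + (x - y)) = x - 2^-1 *: (y' + y).
      rewrite addrACA -opprD scalerBr -mulr2n -(scaler_nat 2 x) scalerA mulVf ?scale1r//.
    exact: dle.
  have := parallelogram (x - y') (x - y).
  have -> : x - y' - (x - y) = y - y' by rewrite opprB addrC subrKA.
  have := normr_ge0 (x - y); have := normr_ge0 (x - y'); move: mid yr y'r re r1 r0 d0.
  rewrite -/d; clear; nra.
have [p Fp] : exists p : H, F --> p by exists (lim F); exact: cauchy_cvg Fc.
have Mp : M p.
  apply: (@closed_cvg _ _ F _ id M Mcl _ p Fp).
  by exists 1 => //= y [].
have pd : `|x - p| <= d.
  apply/ler_addgt0Pr => e e0.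
  have : (fun y => `|x - y|) y @[y --> F] --> `|x - p|.
    by apply: cvg_norm; apply: cvgB => //; exact: cvg_cst.
  move=> h; apply: (cvgr_to_le h); exists e => //= y [_ /ltW]; exact.
exists (x - p).
  by apply: contra_notN Mx; rewrite subr_eq0 => /eqP ->.
move=> y My; have [->|y0] := eqVneq y 0; first by rewrite inner0r.
have y0' : 0 < `|y| ^+ 2 by rewrite exprn_gt0// normr_gt0.
(* This [t] minimizes the norm of [x - p - t y]; minimality of [|x - p|] then forces
   [u^2 / |y|^2 <= 0], where [u] is the inner product to be killed. *)
pose t := '[x - p, y] / `|y| ^+ 2.
have : d <= `|(x - p) - t *: y|.
  by rewrite -addrA -opprD (addrC p); apply: dle; exact: Mlin.
move=> /(le_trans pd); rewrite -ler_sqr ?nnegrE// [X in _ <= X]sqr_normB.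
rewrite innerZr normrZ exprMn real_normK ?num_real// /t.
set u := '[_, _]; move=> h.
have : u ^+ 2 / `|y| ^+ 2 <= 0.
  suff : u ^+ 2 / `|y| ^+ 2 = 2 * (u / `|y| ^+ 2 * u) - (u / `|y| ^+ 2) ^+ 2 * `|y| ^+ 2 by lra.
  by field; rewrite normr_eq0.
by rewrite pmulr_lle0 ?invr_gt0// => u0; apply/eqP; rewrite -sqrf_eq0 eq_le u0 sqr_ge0.
Qed.

(** If [f] is not zero, take [z] orthogonal to its kernel; since [x - (f x / f z) z] lies in the
    kernel, pairing it with [z] expresses [f x] through ['[z, x]]. *)
Lemma riesz (f : {linear H -> R^o}) : continuous f ->
  exists xi, forall x, f x = '[x, xi].
Proof.
move=> fc; have [fT|fT] := eqVneq (f @^-1` [set 0]) setT.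
  by exists 0 => x; rewrite inner0r; have : (f @^-1` [set 0]) x by rewrite fT.
have [z z0 zf] : exists2 z, z != 0 & forall y, f y = 0 -> '[z, y] = 0.
  apply: (proper_closed_orthogonal _ _ _ fT).
  - exact: linear0.
  - by move=> a x y /= fx fy; rewrite linearP fx fy scaler0 addr0.
  - by apply: preimage_closed => // x _; exact: fc.
have fz : f z != 0.
  apply/eqP => fz; have := zf z fz; rewrite inner_normE => /eqP.
  by rewrite expf_eq0 /= normr_eq0 (negbTE z0).
have z2 : `|z| ^+ 2 != 0 by rewrite expf_eq0 /= normr_eq0.
exists ((f z / `|z| ^+ 2) *: z) => x.
have := zf (x - (f x / f z) *: z); rewrite innerBr innerZr inner_normE => h.
have {}h : '[z, x] = f x / f z * `|z| ^+ 2.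
  apply/eqP; rewrite -subr_eq0 h//= linearB linearZ /= /GRing.scale /=.
  by rewrite divfK// subrr.
rewrite innerZr innerC h; by field; rewrite fz normr_eq0 z0.
Qed.
End hilbert.

(** * Probabilities on discrete groups *)

#[local] Existing Instance summability.totally_filter.

Lemma measurable_discrete (G : groupType) (D : set (discrete G)) : measurable D.
Proof. by []. Qed.

#[local] Hint Extern 0 (measurable _) => exact: measurable_discrete : core.

Lemma measurable_fun_discrete d (U : measurableType d) (G : groupType)
  (D : set (discrete G)) (f : discrete G -> U) : measurable_fun D f.
Proof. by move=> _ Y _. Qed.

#[local] Hint Extern 0 (measurable_fun _ _) =>
  exact: measurable_fun_discrete : core.

Section discrete_probability.
Variables (R : realType) (G : groupType) (P : probability (discrete G) R).
Implicit Types (D : set (discrete G)) (F : G -> R) (B : {fset G}) (C : R).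

Lemma integrable_bounded D F C :
  (forall g, D g -> `|F g| <= C) -> P.-integrable D (EFin \o F).
Proof.
move=> FC; apply: measurable_bounded_integrable => //.
  by rewrite (le_lt_trans (probability_le1 _ _))// ltry.
exists C; split; first exact: num_real.
by move=> M CM g Dg; rewrite /= (le_trans (FC g Dg))// ltW.
Qed.

Lemma normr_Rintegral_le D F C :
  (forall g, D g -> `|F g| <= C) -> `|\int[P]_(g in D) F g| <= C * fine (P D).
Proof.
move=> FC; rewrite -Rintegral_cst//.
apply: le_trans (le_normr_Rintegral _ _) _ => //; first exact: integrable_bounded FC.
apply: le_Rintegral => //.
  by apply: (@integrable_bounded _ _ C) => g Dg; rewrite normr_id FC.
apply: (@integrable_bounded _ _ `|C|) => g Dg //.
Qed.

Definition mass (g : G) : R := fine (P [set g]).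

Lemma massE g : P [set g] = (mass g)%:E.
Proof. by rewrite fineK// fin_num_measure. Qed.

Lemma mass_ge0 g : 0 <= mass g.
Proof. exact: fine_ge0. Qed.

Lemma Rintegral_fset B F C : (forall g, `|F g| <= C) ->
  \int[P]_(g in [set` B]) F g = \sum_(g <- B) mass g * F g.
Proof.
move=> FC; have -> : [set` B] = [set` (B : seq G)] by [].
have : uniq (B : seq G) by exact: fset_uniq.
elim: (B : seq G) => [_|a s IH /= /andP[nas us]].
  by rewrite set_nil Rintegral_set0 big_nil.
have -> : [set` a :: s] = [set a] `|` [set` s].
  apply/seteqP; split => x /=; rewrite inE; first by case/predU1P; [left|right].
  by case=> [->|->]; rewrite ?eqxx ?orbT.
rewrite Rintegral_setU//; last 2 first.
- exact: integrable_bounded (fun g _ => FC g).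
- by apply/eqP/seteqP; split => // x /= [-> xs]; rewrite xs in nas.
rewrite big_cons IH//; congr (_ + _).
rewrite (@eq_Rintegral _ _ _ P [set a] (cst (F a))); last first.
  by move=> x /set_mem ->.
by rewrite Rintegral_cst// mulrC.
Qed.

Lemma sum_mass B : \sum_(g <- B) mass g = fine (P [set` B]).
Proof.
have := @Rintegral_fset B (cst 1) 1 (fun=> _).
under eq_bigr do rewrite mulr1; move=> <-; last by move=> ?; rewrite normr1.
by rewrite Rintegral_cst// mul1r.
Qed.

(** Countability enters here: an injection [f] into the naturals gives tails [A n] that decrease to
    the empty set and have finite complements, and continuity from above applies. *)
Lemma fset_tight : countable [set: G] -> forall e, 0 < e ->
  \forall B \near @summability.totally G, fine (P (~` [set` B])) <= e.
Proof.
move=> /countable_injP[f finj] e e0.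
pose A n : set (discrete G) := [set g | (n <= f g)%N].
have PA : P (A n) @[n --> \oo] --> P (\bigcap_n A n).
  apply: nonincreasing_cvg_mu => //.
    by rewrite (le_lt_trans (probability_le1 _ _))// ltry.
  by move=> m n mn; apply/subsetPset => g /=; exact: leq_trans.
have A0 : \bigcap_n A n = set0.
  by apply/seteqP; split=> // g /(_ (f g).+1 I); rewrite /A /= ltnn.
rewrite A0 measure0 in PA.
have /fine_cvgP[_ /cvgr0Pnorm_le /(_ _ e0)[n _ Pn]] := PA.
have finA : finite_set (~` A n).
  have -> : ~` A n = f @^-1` `I_n.
    by apply/seteqP; split => g /=; rewrite ltnNge => /negP.
  by apply: finite_preimage => // x y _ _; apply: finj; exact: mem_set.
exists (fset_set (~` A n)) => // B /= AB.
apply: le_trans (Pn n (leqnn n)); rewrite /= ger0_norm ?fine_ge0//.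
apply: fine_le; rewrite ?fin_num_measure//.
apply: le_measure; [exact: mem_set|exact: mem_set|] => g /=; apply: contra_notP => Ang.
by apply: (fsubsetP AB); rewrite in_fset_set//; exact: mem_set.
Qed.

(** The error of a partial sum is the integral over the complement of [B], which tightness
    controls. *)
Lemma Rintegral_fset_cvg F C : countable [set: G] -> (forall g, `|F g| <= C) ->
  summability.partial_sum (fun g => mass g * F g) @ summability.totally -->
  \int[P]_g F g.
Proof.
move=> cG FC; have C0 : 0 <= C by apply: le_trans (FC 1%g).
apply/cvgrPdist_le => e e0.
(* Dividing by [C + 1] instead of [C] covers the case [C = 0]; the same device recurs below. *)
have : 0 < e / (C + 1) by rewrite divr_gt0// ltr_wpDl.
move=> /(fset_tight cG); apply: filterS => B PB.
rewrite /summability.partial_sum -(big_seq_fsetE _ _ predT (fun g => mass g * F g))/=.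
rewrite -(Rintegral_fset _ FC) -(setUv [set` B]).
rewrite Rintegral_setU//; last 2 first.
- exact: integrable_bounded (fun g _ => FC g).
- by apply/eqP; rewrite setICr.
rewrite addrC addKr; apply: le_trans (normr_Rintegral_le (fun g _ => FC g)) _.
apply: le_trans (ler_wpM2l C0 PB) _.
rewrite mulrA ler_pdivrMr ?ltr_wpDl// mulrC ler_wpM2l ?(ltW e0)//.
by rewrite lerDl.
Qed.

End discrete_probability.

(** * Reiter sequences *)

Section reiter_sequences.
Variables (R : realType) (G : groupType) (mu : nat -> probability (discrete G) R).
Implicit Types (F : G -> R) (B : {fset G}) (C : R) (g h k : G).

(** Translation by [k] permutes the finite subsets and preserves inclusion; this is the reindexing
    behind the change of variable [g -> h * g]. *)
Lemma totally_translate k :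
  (fun B => [fset (k * g)%g | g in B]%fset) @ @summability.totally G -->
  @summability.totally G.
Proof.
move=> Q [A _ AQ]; exists [fset (k^-1 * g)%g | g in A]%fset => // B /= AB.
apply: AQ => /=; apply/fsubsetP => g gA; apply/imfsetP.
exists (k^-1 * g)%g; last by rewrite mulVKg.
by apply: (fsubsetP AB); apply/imfsetP; exists g.
Qed.

(** The translation is moved from [F] to the weights, so that this integral and that of [F] become
    limits of sums of the same values [F g] over the same finite sets. *)
Lemma Rintegral_translate (P : probability (discrete G) R) F C h :
  countable [set: G] -> (forall g, `|F g| <= C) ->
  summability.partial_sum (fun g => mass P (h^-1 * g)%g * F g)
    @ summability.totally --> \int[P]_g F (h * g)%g.
Proof.
move=> cG FC; have := Rintegral_fset_cvg (P := P) cG (fun g => FC (h * g)%g).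
move=> /(cvg_comp _ _ (totally_translate (h^-1)%g)); apply: cvg_trans.
apply: near_eq_cvg; apply: nearW => B; rewrite /= /summability.partial_sum.
rewrite -(big_seq_fsetE _ _ predT (fun g => mass P g * F (h * g)%g))/=.
rewrite -(big_seq_fsetE _ _ predT (fun g => mass P (h^-1 * g)%g * F g))/=.
rewrite big_imfset/=; last by move=> x y _ _; exact: mulgI.
by apply: eq_bigr => g _; rewrite mulVKg.
Qed.

Definition shift_variation (P : probability (discrete G) R) h : \bar R :=
  (\esum_(g in [set: G]) `|P [set g] - P [set (h^-1 * g)%g]|)%E.

Lemma sum_mass_diff_le (P : probability (discrete G) R) h B :
  ((\sum_(g <- B) `|mass P g - mass P (h^-1 * g)%g|)%:E <=
   shift_variation P h)%E.
Proof.
apply: esum_ge; exists [set` B]; first by split=> //; exact: finite_fset.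
rewrite -fsbig_seq ?fset_uniq// -sumEFin; apply: lee_sum => g _.
by rewrite !massE -EFinB abse_EFin.
Qed.

(** On each finite set the two partial sums differ by at most [C] times the sum of the mass
    differences, and the bound survives the limit. *)
Lemma Rintegral_translate_le (P : probability (discrete G) R) F C h r :
  countable [set: G] -> (forall g, `|F g| <= C) ->
  (shift_variation P h <= r%:E)%E ->
  `|\int[P]_g F g - \int[P]_g F (h * g)%g| <= C * r.
Proof.
move=> cG FC vr; have C0 : 0 <= C by apply: le_trans (FC 1%g).
have := cvgB (Rintegral_fset_cvg (P := P) cG FC) (Rintegral_translate (P := P) (h := h) cG FC).
move=> /(_ _)/cvg_norm/cvgr_to_le; apply; apply: nearW => B.
rewrite /= !fctE /summability.partial_sum.
rewrite -(big_seq_fsetE _ _ predT (fun g => mass P g * F g))/=.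
rewrite -(big_seq_fsetE _ _ predT (fun g => mass P (h^-1 * g)%g * F g))/=.
rewrite -sumrB (le_trans (ler_norm_sum _ _ _))//.
apply: (@le_trans _ _ (C * \sum_(g <- B) `|mass P g - mass P (h^-1 * g)%g|)).
  rewrite mulr_sumr; apply: ler_sum => g _; rewrite -mulrBl normrM mulrC.
  by rewrite ler_wpM2r.
rewrite ler_wpM2l// -lee_fin; exact: le_trans (sum_mass_diff_le _ _ _) vr.
Qed.

Lemma sum_cvg0 (I : Type) (s : seq I) (u : I -> nat -> R) :
  (forall i, u i n @[n --> \oo] --> 0) ->
  \sum_(i <- s) u i n @[n --> \oo] --> 0.
Proof.
move=> u0; elim: s => [|i s IH].
  by under eq_fun do rewrite big_nil; exact: cvg_cst.
have := cvgD (u0 i) IH; rewrite addr0; under [in X in _ -> X]eq_fun do rewrite big_cons; exact.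
Qed.

Hypothesis mu_reiter : reiter mu.

Lemma shift_variation_near h r : 0 < r ->
  \forall n \near \oo, (shift_variation (mu n) h <= r%:E)%E.
Proof.
move=> r0; have /fine_cvgP[fn /cvgr0Pnorm_le /(_ _ r0)] := mu_reiter h.
apply: filterS2 fn => n fn /= nr; rewrite /shift_variation -(fineK fn) lee_fin.
exact: le_trans (ler_norm _) nr.
Qed.

Lemma Rintegral_translate_cvg F C h :
  countable [set: G] -> (forall g, `|F g| <= C) ->
  \int[mu n]_g F g - \int[mu n]_g F (h * g)%g @[n --> \oo] --> 0.
Proof.
move=> cG FC; have C0 : 0 <= C by apply: le_trans (FC 1%g).
apply/cvgr0Pnorm_le => e e0.
have : 0 < e / (C + 1) by rewrite divr_gt0// ltr_wpDl.
move=> /(shift_variation_near h); apply: filterS => n.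
move=> /(Rintegral_translate_le cG FC) /le_trans; apply.
rewrite mulrA ler_pdivrMr ?ltr_wpDl// mulrC ler_wpM2l ?(ltW e0)//.
by rewrite lerDl.
Qed.

Lemma mass_diff_cvg0 g k : mass (mu n) g - mass (mu n) k @[n --> \oo] --> 0.
Proof.
apply/cvgr0Pnorm_le => e e0.
(* The shift [h = g k^-1] satisfies [h^-1 g = k], so the difference sought is a single term of the
   variation. *)
have := shift_variation_near (g * k^-1)%g e0; apply: filterS => n.
move=> /(le_trans (sum_mass_diff_le _ _ [fset g]%fset)).
by rewrite lee_fin big_seq_fset1 invgM invgK -mulgA mulVg mulg1.
Qed.

Hypothesis infG : infinite_set [set: G].

(* All points asymptotically have the same mass, and there are infinitely many. *)
Lemma mass_cvg0 g : mass (mu n) g @[n --> \oo] --> 0.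
Proof.
apply/cvgr0Pnorm_le => e e0.
(* With [m] the number of points of [B], eventually [m] times the mass of [g] exceeds the mass of
   [B] by at most 1, so it is at most 2; [N] ensures [2 <= e m]. *)
pose N := (Num.truncn (2 / e)).+1.
have [B _ NB] := infinite_set_fset N infG.
have N0 : 0 < #|` B|%:R :> R by rewrite ltr0n (leq_trans _ NB).
have Ne : 2 <= e * #|` B|%:R.
  rewrite -ler_pdivrMl// mulrC (le_trans (ltW (truncnS_gt _)))//.
  by rewrite ler_nat.
have := @sum_cvg0 _ B (fun k n => mass (mu n) g - mass (mu n) k) (mass_diff_cvg0 g).
move=> /cvgr0Pnorm_le /(_ _ ltr01); apply: filterS => n.
rewrite sumrB big_const_seq count_predT iter_addr_0 => /(le_trans (ler_norm _)) h.
have : \sum_(k <- B) mass (mu n) k <= 1.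
  rewrite sum_mass -[leRHS]/(fine 1%:E).
  by apply: fine_le; rewrite ?fin_num_measure//; exact: probability_le1.
move=> h1; rewrite ger0_norm ?mass_ge0// -(ler_pM2r N0); apply: le_trans Ne.
rewrite -mulr_natr in h; lra.
Qed.

(** [F] vanishes at infinity: on the finite set where [|F| > e / 2] the masses tend to 0, and
    elsewhere the integral is at most [e / 2]. *)
Lemma Rintegral_cofinite_cvg0 F C : (forall g, `|F g| <= C) ->
  (forall e, 0 < e -> finite_set [set g | e < `|F g|]) ->
  \int[mu n]_g F g @[n --> \oo] --> 0.
Proof.
move=> FC Ffin; apply/cvgr0Pnorm_le => e e0.
have e20 : 0 < e / 2 by rewrite divr_gt0.
pose B := fset_set [set g | e / 2 < `|F g|].
have : \sum_(g <- B) mass (mu n) g * F g @[n --> \oo] --> 0.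
  apply: sum_cvg0 => g; rewrite -[0](mul0r (F g)).
  by apply: cvgMr_tmp; exact: mass_cvg0.
move=> /cvgr0Pnorm_le /(_ _ e20); apply: filterS => n.
rewrite -(@Rintegral_fset _ _ (mu n) B F C FC) => Be.
rewrite -(setUv [set` B]) Rintegral_setU//; last 2 first.
- exact: integrable_bounded (fun g _ => FC g).
- by apply/eqP; rewrite setICr.
rewrite (le_trans (ler_normD _ _))// (splitr e) lerD//.
apply: le_trans (@normr_Rintegral_le _ _ _ _ _ (e / 2) _) _.
  move=> g /= gB; rewrite leNgt; apply: contra_notN gB => gB.
  by rewrite in_fset_set ?mem_set//; exact: Ffin.
rewrite ler_piMr ?(ltW e20)// -[leRHS]/(fine 1%:E); apply: fine_le; rewrite ?fin_num_measure//.
exact: probability_le1.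
Qed.

End reiter_sequences.

(** * Mean ergodic theorem for bounded maps whose equivariance defect vanishes at infinity *)

Section ergodic_means.
Variables (R : realType) (G : groupType) (K : hilbertType R).
Variables (mu : nat -> probability (discrete G) R) (sigma : G -> K -> K).
Variables (c : G -> K) (C : R).
Hypotheses (infG : infinite_set [set: G]) (cG : countable [set: G]).
Hypothesis mu_reiter : reiter mu.
Hypothesis sigma_rep : orthogonal_representation sigma.
Hypothesis c_bounded : forall g, `|c g| <= C.
Hypothesis c_equivariant : forall h e, 0 < e ->
  finite_set [set g | e < `|sigma h (c g) - c (h * g)%g|].
Implicit Types (xi z : K).

Let C_ge0 : 0 <= C.
Proof. exact: le_trans (c_bounded 1%g). Qed.

Let inner_bounded xi g : `|'[c g, xi]| <= C * `|xi|.
Proof. by rewrite (le_trans (inner_le_norm _ _))// ler_wpM2r. Qed.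

Let integrable_inner n xi : (mu n).-integrable setT (EFin \o (fun g => '[c g, xi])).
Proof. exact: integrable_bounded (fun g _ => inner_bounded xi g). Qed.

Let null_space : set K := [set xi | \int[mu n]_g '[c g, xi] @[n --> \oo] --> 0].

Let null_space_linear a xi z :
  null_space xi -> null_space z -> null_space (a *: xi + z).
Proof.
rewrite /null_space /= => xi0 z0.
have -> : (fun n => \int[mu n]_g '[c g, a *: xi + z]) =
    (fun n => a * \int[mu n]_g '[c g, xi] + \int[mu n]_g '[c g, z]).
  apply/funext => n; under eq_Rintegral do rewrite innerDr innerZr.
  rewrite RintegralD ?RintegralZl//; try exact: integrable_inner.
  apply: (@integrable_bounded _ _ _ _ _ (`|a| * (C * `|xi|))) => g _.
  by rewrite normrM ler_wpM2l.
have := cvgD (cvgMl_tmp (a := a) xi0) z0; rewrite mulr0 addr0; exact.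
Qed.

(** Replacing [xi] by a nearby [z] changes every integral by at most [C |xi - z|], uniformly in
    [n]. *)
Let null_space_closed : closed null_space.
Proof.
move=> xi cl_xi; apply/cvgr0Pnorm_le => e e0.
pose r := e / (2 * (C + 1)).
have C1 : 0 < C + 1 by rewrite ltr_wpDl.
have r0 : 0 < r by rewrite divr_gt0// mulr_gt0.
have [z [z0]] := cl_xi _ (nbhsx_ballx xi r r0).
rewrite -ball_normE /= => xiz.
have e20 : 0 < e / 2 by rewrite divr_gt0.
move: z0 => /cvgr0Pnorm_le /(_ _ e20); apply: filterS => n zn.
have -> : \int[mu n]_g '[c g, xi] =
    \int[mu n]_g '[c g, xi - z] + \int[mu n]_g '[c g, z].
  rewrite -RintegralD//; try exact: integrable_inner.
  by apply: eq_Rintegral => g _; rewrite -innerDr subrK.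
rewrite (le_trans (ler_normD _ _))// (splitr e) lerD//.
apply: (@le_trans _ _ (C * `|xi - z| * fine (mu n setT))).
  by apply: normr_Rintegral_le => g _; exact: inner_bounded.
rewrite probability_setT mulr1 (le_trans (ler_wpM2l C_ge0 (ltW xiz)))//.
have -> : e / 2 = (C + 1) * r by rewrite /r; field; rewrite gt_eqF.
by rewrite ler_wpM2r ?(ltW r0)// lerDl.
Qed.

(** By orthogonality ['[c g, xi]] equals ['[sigma h (c g), sigma h xi]]. Exchanging [sigma h (c g)]
    for [c (h * g)] costs the defect [d], which vanishes at infinity; what remains is the difference
    between an integral and its translate, which the Reiter property sends to 0. *)
Let null_space_coboundary h xi : null_space (xi - sigma h xi).
Proof.
have [sigma_orth _] := sigma_rep; have [_ _ sigma_inner] := sigma_orth h.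
pose d g := sigma h (c g) - c (h * g)%g.
have dC g : `|d g| <= 2 * C.
  rewrite (le_trans (ler_normB _ _))// mulr_natl mulr2n lerD//.
  by rewrite -(@ler_pXn2r _ 2) ?nnegrE// -inner_normE sigma_inner inner_normE ler_pXn2r ?nnegrE.
have dxi g : `|'[d g, sigma h xi]| <= 2 * C * `|sigma h xi|.
  by rewrite (le_trans (inner_le_norm _ _))// ler_wpM2r.
rewrite /null_space /=.
have -> : (fun n => \int[mu n]_g '[c g, xi - sigma h xi]) = (fun n =>
    \int[mu n]_g '[d g, sigma h xi] -
    (\int[mu n]_g '[c g, sigma h xi] - \int[mu n]_g '[c (h * g)%g, sigma h xi])).
  apply/funext => n.
  have int_shift :
      (mu n).-integrable setT (EFin \o (fun g => '[c (h * g)%g, sigma h xi])).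
    by apply: (@integrable_bounded _ _ _ _ _ (C * `|sigma h xi|)) => g _.
  rewrite -!RintegralB//; try exact: integrable_inner.
  - apply: eq_Rintegral => g _; rewrite innerBr -(sigma_inner (c g)) /d innerBl.
    by rewrite opprB addrA subrK.
  - by apply: (@integrable_bounded _ _ _ _ _ (2 * C * `|sigma h xi|)) => g _.
  - apply: (@integrable_bounded _ _ _ _ _ (C * `|sigma h xi| + C * `|sigma h xi|)).
    by move=> g _; rewrite (le_trans (ler_normB _ _))// lerD.
have cofin e : 0 < e -> finite_set [set g | e < `|'[d g, sigma h xi]|].
  move=> e0; have xi1 : 0 < `|sigma h xi| + 1 by rewrite ltr_wpDl.
  apply: sub_finite_set (c_equivariant h (divr_gt0 e0 xi1)) => g /= eg.
  rewrite ltr_pdivrMr// (lt_le_trans eg)// (le_trans (inner_le_norm _ _))//.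
  by rewrite ler_wpM2l// lerDl.
have := cvgB (Rintegral_cofinite_cvg0 mu_reiter infG dxi cofin)
  (Rintegral_translate_cvg mu_reiter h cG (inner_bounded (sigma h xi))).
by rewrite subr0; exact.
Qed.

(* A vector z orthogonal to [null_space] is orthogonal to all coboundaries
   z - sigma h z, hence is invariant. *)
Lemma ergodic_mean_cvg0 : ergodic sigma ->
  forall xi, \int[mu n]_g '[c g, xi] @[n --> \oo] --> 0.
Proof.
move=> sigma_ergodic xi.
have [nullT|nullT] := eqVneq null_space setT.
  by have : null_space xi by rewrite nullT.
have null0 : null_space 0.
  rewrite /null_space /=; under eq_fun do under eq_Rintegral do rewrite inner0r.
  by under eq_fun do rewrite Rintegral_cst// mul0r; exact: cvg_cst.
have [z z0 zorth] :=
  proper_closed_orthogonal null0 null_space_linear null_space_closed nullT.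
case/eqP: z0; apply: sigma_ergodic => h; apply/eqP; rewrite -subr_eq0 -normr_eq0.
have [sigma_orth _] := sigma_rep; have [_ _ sigma_inner] := sigma_orth h.
(* Orthogonality yields ['[z, sigma h z] = '[z, z]]; as [sigma h] is isometric, expanding
   [|sigma h z - z|^2] gives 0. *)
have := zorth _ (null_space_coboundary h z); rewrite innerBr => /eqP.
rewrite subr_eq0 => /eqP zz; rewrite -sqrf_eq0 sqr_normB (innerC _ z) -zz.
by rewrite -!inner_normE sigma_inner; apply/eqP; lra.
Qed.

End ergodic_means.

(** * Word length and cocycles *)

Section word_length.
Variables (G : groupType) (S : {fset G}).
Hypotheses (Ssym : symmetric_gen S) (Sgen : generating S).
Implicit Types (g h : G) (n : nat).

Lemma is_word_length1 : is_word_length S 1%g 0.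
Proof. by exists [::]; rewrite big_nil. Qed.

Lemma is_word_lengthM g h m n :
  is_word_length S g m -> is_word_length S h n -> is_word_length S (g * h)%g (m + n).
Proof.
move=> [v [<- vS <-]] [w [<- wS <-]]; exists (v ++ w); split.
- by rewrite size_cat.
- by move=> s; rewrite mem_cat => /orP[/vS|/wS].
- by rewrite big_cat.
Qed.

Lemma is_word_length_gen s : s \in S -> is_word_length S s 1.
Proof.
by move=> sS; exists [:: s]; rewrite big_seq1; split=> // t; rewrite inE => /eqP ->.
Qed.

Lemma is_word_lengthV g n : is_word_length S g n -> is_word_length S (g^-1)%g n.
Proof.
move=> [w [<- wS <-]]; elim: w wS => [|s w IH] wS.
  by rewrite big_nil invg1; exact: is_word_length1.
rewrite big_cons invgM /= -addn1; apply: is_word_lengthM.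
  by apply: IH => t tw; apply: wS; rewrite inE tw orbT.
by apply: is_word_length_gen; apply: Ssym; apply: wS; rewrite inE eqxx.
Qed.

(** The elements represented by words in [S] are closed under products and, by symmetry of [S],
    under inverses. *)
Lemma is_word_length_ex g : exists n, is_word_length S g n.
Proof.
suff -> : (exists n, is_word_length S g n) = [set: G] g by [].
rewrite -(Sgen (A := [set g | exists n, is_word_length S g n]))//.
- by exists 0; exact: is_word_length1.
- by move=> x y /= [m xm] [n yn]; exists (m + n)%N; exact: is_word_lengthM.
- by move=> x /= [n xn]; exists n; exact: is_word_lengthV.
- by move=> s /= sS; exists 1; exact: is_word_length_gen.
Qed.

Lemma word_lengthP g : is_word_length S g (word_length S g).
Proof.
rewrite /word_length; case: pselect => [e|[]]; last first.
  by have [n gn] := is_word_length_ex g; exists n; exact/asboolP.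
by case: ex_minnP => n /asboolP.
Qed.

Lemma word_length_min g n : is_word_length S g n -> (word_length S g <= n)%N.
Proof.
move=> gn; rewrite /word_length; case: pselect => [e|]; last by [].
by case: ex_minnP => m _; apply; exact/asboolP.
Qed.

Lemma word_lengthM g h :
  (word_length S (g * h)%g <= word_length S g + word_length S h)%N.
Proof. by apply: word_length_min; apply: is_word_lengthM; exact: word_lengthP. Qed.

(** Induction on the length: removing the first letter exhibits the words of length [m + 1] as
    products of the finite set [S] with those of length [m]. *)
Lemma finite_word_ball n : finite_set [set g | (word_length S g <= n)%N].
Proof.
have fin m : finite_set [set g | is_word_length S g m].
  elim: m => [|m IH].
    apply: sub_finite_set (finite_set1 1%g) => g /= [w [/size0nil -> _ <-]].
    by rewrite big_nil.
  apply: sub_finite_set (finite_image2 (fun s h => (s * h)%g) (finite_fset S) IH).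
  move=> g /= [[|s w] [//= [sw] wS <-]]; exists s; first by apply: wS; rewrite inE eqxx.
  exists (\prod_(t <- w) t)%g; last by rewrite big_cons.
  by exists w; split=> // t tw; apply: wS; rewrite inE tw orbT.
apply: (@sub_finite_set _ _ (\bigcup_(m in `I_n.+1) [set g | is_word_length S g m])).
  by move=> g /= gn; exists (word_length S g) => //; exact: word_lengthP.
by apply: bigcup_finite => // m _; exact: fin.
Qed.

(** Supplies the countability that the integration lemmas require, as a union of finite balls. *)
Lemma generating_countable : countable [set: G].
Proof.
have -> : [set: G] = \bigcup_n [set g | (word_length S g <= n)%N].
  by apply/seteqP; split=> // g _; exists (word_length S g) => /=.
by apply: bigcup_countable => // n _; apply: finite_set_countable; exact: finite_word_ball.
Qed.

(** * Growth and normalization of cocycles *)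

Variables (R : realType) (H : hilbertType R) (pi : G -> H -> H) (b : G -> H).
Hypotheses (pi_rep : orthogonal_representation pi) (b_cocycle : cocycle pi b).

Lemma orthogonal_norm g x : `|pi g x| = `|x|.
Proof.
have [/(_ g)[_ _ pi_inner] _] := pi_rep.
by apply/eqP; rewrite -(@eqrXn2 _ 2)// -!inner_normE pi_inner.
Qed.

(** The identity at [(1, 1)] gives [pi 1 (b 1) = 0], and [pi 1] preserves norms. *)
Lemma cocycle1 : b 1%g = 0.
Proof.
have := b_cocycle 1%g 1%g; rewrite mulg1 -[LHS]add0r => /addIr /esym pib.
by apply/eqP; rewrite -normr_eq0 -(orthogonal_norm 1%g) pib normr0.
Qed.

(** Along a shortest word each letter [s] adds at most [|b s|], by the cocycle identity and
    isometry; the sum over [S] bounds all of these at once. *)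
Lemma cocycle_le_word_length :
  exists2 L : R, 0 <= L & forall g, `|b g| <= L * (word_length S g)%:R.
Proof.
pose L := \sum_(s <- S) `|b s|.
have bS s : s \in S -> `|b s| <= L.
  move=> sS; rewrite /L (big_rem s)//= lerDl; exact: sumr_ge0.
exists L => [|g]; first exact: sumr_ge0.
have [w [<- wS <-]] := word_lengthP g; elim: w wS {g} => [|s w IH] wS.
  by rewrite big_nil cocycle1 normr0 mulr0.
rewrite big_cons b_cocycle (le_trans (ler_normD _ _))// orthogonal_norm /=.
rewrite -addn1 natrD mulrDr mulr1 lerD ?bS ?wS ?inE ?eqxx//.
by apply: IH => t tw; apply: wS; rewrite inE tw orbT.
Qed.

Variable L : R.
Hypotheses (L_ge0 : 0 <= L) (bL : forall g, `|b g| <= L * (word_length S g)%:R).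

Let c g : H := (word_length S g)%:R^-1 *: b g.

Lemma normalized_cocycle_le g : `|c g| <= L.
Proof.
rewrite normrZ ger0_norm ?invr_ge0//.
(* At length 0 the convention [0^-1 = 0] makes [c g] vanish. *)
have [->|wg0] := eqVneq (word_length S g) 0%N; first by rewrite invr0 mul0r.
by rewrite ler_pdivrMl ?ltr0n ?lt0n// mulrC bL.
Qed.

(* The defect at g is at most 2 L (|h| + |h^-1|) / |g|, and balls are finite. *)
Lemma normalized_cocycle_equivariant h e : 0 < e ->
  finite_set [set g | e < `|pi h (c g) - c (h * g)%g|].
Proof.
(* The length of [h^-1] is included because [g = h^-1 (h g)]; thus the lengths of [g] and [h * g]
   differ by at most [k]. *)
move=> e0; pose k := (word_length S h + word_length S (h^-1)%g)%N.
pose N := (Num.truncn (2 * L * k%:R / e)).+1.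
apply: sub_finite_set (finite_word_ball N) => g /=; apply: contra_ltT.
rewrite -ltnNge => Ng.
pose x : R := (word_length S g)%:R; pose y : R := (word_length S (h * g)%g)%:R.
have x0 : 0 < x by rewrite ltr0n (leq_ltn_trans _ Ng).
have xe : 2 * L * k%:R <= e * x.
  rewrite -ler_pdivrMl// mulrC (le_trans (ltW (truncnS_gt _)))//.
  by rewrite ler_nat ltnW.
have hk : (word_length S h)%:R <= k%:R :> R by rewrite ler_nat leq_addr.
have yx : y <= k%:R + x.
  rewrite -natrD ler_nat (leq_trans (word_lengthM _ _))// leq_add2r leq_addr//.
have xy : x <= k%:R + y.
  rewrite -natrD ler_nat -[in X in (X <= _)%N](mulKg h g).
  by rewrite (leq_trans (word_lengthM _ _))// leq_add2r leq_addl.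
have y0 : 0 <= y by exact: ler0n.
have [pi_orth _] := pi_rep; have [pi_linear _ _] := pi_orth h.
have piZ a u : pi h (a *: u) = a *: pi h u.
  have pi0 : pi h 0 = 0.
    by apply/eqP; rewrite -normr_eq0 orthogonal_norm normr0.
  by rewrite -[a *: u]addr0 pi_linear pi0 addr0.
have pib : pi h (b g) = b (h * g)%g - b h by rewrite b_cocycle addrK.
(* The defect splits into a change of normalization and the single vector [b h] scaled by [1 / |g|];
   each part is at most [L k / x]. *)
have -> : pi h (c g) - c (h * g)%g = (x^-1 - y^-1) *: b (h * g)%g - x^-1 *: b h.
  by rewrite /c piZ pib scalerBr scalerBl addrAC.
rewrite (le_trans (ler_normB _ _))// !normrZ (gtr0_norm (_ : 0 < x^-1)) ?invr_gt0//.
have b1 : `|x^-1 - y^-1| * `|b (h * g)%g| <= L * k%:R / x.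
  apply: le_trans (ler_wpM2l (normr_ge0 _) (bL _)) _; rewrite -/y.
  (* If [h * g] has length 0, the factor [L * y] already vanishes; otherwise [y] cancels and
     [|y - x| <= k] remains to be used. *)
  have [->|yn0] := eqVneq y 0; first by rewrite !mulr0 divr_ge0 ?mulr_ge0// ltW.
  have -> : x^-1 - y^-1 = (y - x) / (x * y) by field; rewrite yn0 gt_eqF.
  have yp : 0 < y by rewrite lt0r yn0.
  rewrite normrM normfV (gtr0_norm (mulr_gt0 x0 yp)).
  have -> : `|y - x| / (x * y) * (L * y) = L * `|y - x| / x.
    by field; rewrite yn0 gt_eqF.
  rewrite ler_wpM2r ?invr_ge0 ?(ltW x0)// ler_wpM2l// ler_norml; lra.
have b2 : x^-1 * `|b h| <= L * k%:R / x.
  rewrite mulrC ler_wpM2r ?invr_ge0 ?(ltW x0)// (le_trans (bL _))// ler_wpM2l//.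
apply: le_trans (lerD b1 b2) _; rewrite -mulrDl ler_pdivrMr//; lra.
Qed.

End word_length.

(** * Vector-valued integrals *)

Section vector_valued_integral.
Variables (R : realType) (G : groupType) (H : hilbertType R).
Variables (P : probability (discrete G) R) (c : G -> H) (C : R).
Hypotheses (cG : countable [set: G]) (c_bounded : forall g, `|c g| <= C).

Lemma vintegrable_bounded : vintegrable P c.
Proof.
by apply: (@integrable_bounded _ _ _ _ _ C) => g _; rewrite normr_id.
Qed.

(** [vintegral] is defined as a limit, whose existence is proved here: beyond a finite set [A] of
    almost full mass, enlarging the index set changes the sum by at most [C] times the added
    mass. *)
Lemma vintegral_cvg :
  summability.partial_sum (fun g => mass P g *: c g) @ summability.totally -->
  vintegral P c.
Proof.
have C0 : 0 <= C by apply: le_trans (c_bounded 1%g).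
apply: (@cauchy_cvg H); apply: cauchy_exP => e e0.
have C1 : 0 < C + 1 by rewrite ltr_wpDl.
have [A _ PA] := fset_tight P cG (divr_gt0 e0 C1).
exists (\sum_(g <- A) mass P g *: c g); exists A => // B /= AB.
rewrite -ball_normE /ball_ /= /summability.partial_sum.
rewrite -(big_seq_fsetE _ _ predT (fun g => mass P g *: c g))/=.
rewrite [X in _ - X](big_fsetID _ (mem A)) /=.
rewrite (_ : [fset x in B | x \in A]%fset = A); last first.
  by apply/fsetP => g; rewrite !inE andb_idl//; exact: (fsubsetP AB).
set D := [fset x in B | x \notin A]%fset.
rewrite opprD addrA subrr sub0r normrN (le_lt_trans (ler_norm_sum _ _ _))//.
apply: (@le_lt_trans _ _ (C * \sum_(g <- D) mass P g)).
  rewrite mulr_sumr; apply: ler_sum => g _.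
  by rewrite normrZ ger0_norm ?mass_ge0// mulrC ler_wpM2r ?mass_ge0.
apply: (@le_lt_trans _ _ (C * (e / (C + 1)))).
  rewrite ler_wpM2l// (le_trans _ (PA A _))//= sum_mass.
  apply: fine_le; rewrite ?fin_num_measure//.
  apply: le_measure; [exact: mem_set|exact: mem_set|] => g /=.
  by rewrite /D !inE => /andP[_ /negP].
by rewrite mulrA ltr_pdivrMr// mulrC ltr_pM2l// ltrDl.
Qed.

(** Both sides are limits of the same scalar partial sums, by Cauchy-Schwarz on the left. *)
Lemma inner_vintegral (xi : H) : '[vintegral P c, xi] = \int[P]_g '[c g, xi].
Proof.
have cxi g : `|'[c g, xi]| <= C * `|xi|.
  by rewrite (le_trans (inner_le_norm _ _))// ler_wpM2r.
apply: (cvg_unique _ _ (Rintegral_fset_cvg cG cxi)).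
  exact: norm_hausdorff.
apply/cvgrPdist_le => e e0.
have xi1 : 0 < `|xi| + 1 by rewrite ltr_wpDl.
have := vintegral_cvg; move=> /cvgrPdist_le /(_ _ (divr_gt0 e0 xi1)).
apply: filterS => B; rewrite ler_pdivlMr// /summability.partial_sum => Be.
have -> : \sum_(i : B) mass P (val i) * '[c (val i), xi] =
    '[\sum_(i : B) mass P (val i) *: c (val i), xi].
  apply/esym; elim/big_ind2: _ => [|x r y s <- <-|i _].
  - by rewrite innerC inner0r.
  - by rewrite innerDl.
  - by rewrite innerZl.
rewrite -innerBl (le_trans (inner_le_norm _ _))// (le_trans _ Be)//.
by rewrite ler_wpM2l// lerDl.
Qed.

End vector_valued_integral.

(** Convergence in a supremum of initial topologies is tested on each continuous functional, and
    [riesz] turns such a functional into an inner product. *)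
Lemma weak_cvg (R : realType) (H : hilbertType R) (u : nat -> H) (l : H) :
  (forall xi, '[u n, xi] @[n --> \oo] --> '[l, xi]) ->
  (u n : weak H) @[n --> \oo] --> (l : weak H).
Proof.
move=> ul; apply/cvg_sup => -[f fc] A /= [_ [[B Bop <-] /= Bl BA]].
have [xi fE] := riesz fc.
have := ul xi B; rewrite -fE => /(_ (open_nbhs_nbhs (conj Bop Bl))).
by rewrite !nbhs_simpl /=; apply: filterS => n /=; rewrite -fE => /BA.
Qed.

(** Infinitude matters: let the group of order 2 act on the line by sign, with [S] its generator [s]
    and [b s = v] nonzero. The constant sequence of uniform measures is Reiter, yet the mean is
    [v / 2]. *)
Theorem theorem1 (R : realType) (G : groupType) (H : hilbertType R)
    (pi : G -> H -> H) (b : G -> H) (S : {fset G})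
    (mu : nat -> probability (discrete G) R) :
  infinite_set [set: G] ->
  amenable R G ->
  orthogonal_representation pi ->
  ergodic pi ->
  cocycle pi b ->
  symmetric_gen S ->
  generating S ->
  reiter mu ->
  ((forall n, vintegrable (mu n) (fun g => (word_length S g)%:R^-1 *: b g)) /\
   (vintegral (mu n) (fun g => (word_length S g)%:R^-1 *: b g) : weak H)
     @[n --> \oo] --> (0 : weak H)) /\
  (weakly_mixing pi ->
   forall xi : H,
     (\int[mu n]_g ((word_length S g)%:R^-1 * `|'[b g, xi]|)%:E)%E
       @[n --> \oo] --> 0%E).
Proof.
move=> infG _ pi_rep pi_ergodic b_cocycle Ssym Sgen mu_reiter.
have cG := generating_countable Ssym Sgen.
have [L L0 bL] := cocycle_le_word_length Ssym Sgen pi_rep b_cocycle.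
set c := fun g => (word_length S g)%:R^-1 *: b g.
have cL : forall g, `|c g| <= L := normalized_cocycle_le L0 bL.
have c_equiv := normalized_cocycle_equivariant Ssym Sgen pi_rep b_cocycle L0 bL.
split; first split.
- by move=> n; exact: vintegrable_bounded cL.
- apply: weak_cvg => xi; rewrite innerC inner0r.
  under eq_fun do rewrite (inner_vintegral _ cG cL).
  exact: (ergodic_mean_cvg0 infG cG mu_reiter pi_rep cL c_equiv).
move=> [K [tau [sigma [[tau_inner _] sigma_rep sigma_tau sigma_ergodic]]]] xi.
have normr_tau x y : `|tau x y| = `|x| * `|y|.
  by apply/eqP; rewrite -(@eqrXn2 _ 2)// ?mulr_ge0// exprMn -!inner_normE tau_inner.
(* The tensor square of [c] inherits boundedness and almost equivariance, so the ergodic argument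
   applies to it under [sigma]. *)
pose cc g := tau (c g) (c g).
have ccL g : `|cc g| <= L * L by rewrite normr_tau ler_pM.
have pi_c h g : `|pi h (c g)| <= L by rewrite (orthogonal_norm pi_rep).
have cc_equiv h e : 0 < e ->
    finite_set [set g | e < `|sigma h (cc g) - cc (h * g)%g|].
  move=> e0; have L1 : 0 < 2 * L + 1 by rewrite ltr_wpDl// mulr_ge0.
  apply: sub_finite_set (c_equiv h _ (divr_gt0 e0 L1)) => g /= eg.
  rewrite ltr_pdivrMr// (lt_le_trans eg)// /cc sigma_tau.
  set u := pi h (c g); set v := c (h * g)%g.
  (* Changing one factor at a time bounds the defect of [cc] by [2 L] times that of [c]. *)
  have -> : tau u u - tau v v = tau (u - v) u + tau v (u - v).
    by rewrite linearBl linearBr addrA subrK.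
  rewrite (le_trans (ler_normD _ _))// !normr_tau.
  have uv0 := normr_ge0 (u - v).
  have := ler_wpM2l uv0 (pi_c h g); have := ler_wpM2r uv0 (cL (h * g)%g).
  rewrite -/u -/v; lra.
have sq0 : \int[mu n]_g '[c g, xi] ^+ 2 @[n --> \oo] --> 0.
  (* Tested against [tau xi xi], the vector [cc g] gives exactly ['[c g, xi] ^+ 2]. *)
  have := ergodic_mean_cvg0 infG cG mu_reiter sigma_rep ccL cc_equiv
    sigma_ergodic (tau xi xi).
  by under eq_fun do under eq_Rintegral do rewrite tau_inner.
have cxi g : `|'[c g, xi]| <= L * `|xi|.
  by rewrite (le_trans (inner_le_norm _ _))// ler_wpM2r.
have int_abs n : (mu n).-integrable setT (EFin \o (fun g => `|'[c g, xi]|)).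
  by apply: (@integrable_bounded _ _ _ _ _ (L * `|xi|)) => g _; rewrite normr_id.
have int_sq n : (mu n).-integrable setT (EFin \o (fun g => '[c g, xi] ^+ 2)).
  apply: (@integrable_bounded _ _ _ _ _ ((L * `|xi|) ^+ 2)) => g _.
  by rewrite normrX lerXn2r ?nnegrE ?mulr_ge0.
have abs0 : \int[mu n]_g `|'[c g, xi]| @[n --> \oo] --> 0.
  apply/cvgr0Pnorm_le => e e0; have e20 : 0 < e / 2 by rewrite divr_gt0.
  (* The tolerance [(e / 2)^2] for the squares leaves [e / 2] after the division by [e / 2] in
     [q]. *)
  have := sq0 => /cvgr0Pnorm_le /(_ _ (mulr_gt0 e20 e20)); apply: filterS => n sqn.
  rewrite ger0_norm ?Rintegral_ge0//.
  pose q (g : discrete G) := (e / 2)^-1 * '[c g, xi] ^+ 2.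
  have int_q : (mu n).-integrable setT (EFin \o q).
    exact: (integrableZl (measurable_discrete _) _ (int_sq n)).
  have int_cst : (mu n).-integrable setT (EFin \o cst (e / 2)).
    exact: finite_measure_integrable_cst.
  apply: (@le_trans _ _ (\int[mu n]_g (cst (e / 2) g + q g))).
    apply: le_Rintegral => //.
    - exact: int_abs.
    - exact: (integrableD (measurable_discrete _) int_cst int_q).
    (* AM-GM: |t| <= e / 2 + t ^+ 2 / (e / 2). *)
    move=> g _; rewrite /q /= -(real_normK (num_real '[c g, xi])) -subr_ge0.
    set t := `|_|.
    have -> : e / 2 + (e / 2)^-1 * t ^+ 2 - t =
        (e / 2)^-1 * ((t - e / 4) ^+ 2 + 3 / 16 * e ^+ 2) by field; rewrite gt_eqF.
    by rewrite mulr_ge0 ?invr_ge0 ?(ltW e20)// addr_ge0 ?sqr_ge0// mulr_ge0 ?sqr_ge0.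
  rewrite RintegralD// Rintegral_cst// RintegralZl//; last exact: int_sq.
  rewrite [X in fine X]probability_setT mulr1 [leRHS]splitr lerD2l ler_pdivrMl//.
  exact: le_trans (ler_norm _) sqn.
(* The factor [1 / |g|] is nonnegative and moves inside the absolute value; integrability makes the
   extended integral the image of the real one. *)
have -> : (fun n => \int[mu n]_g ((word_length S g)%:R^-1 * `|'[b g, xi]|)%:E)%E =
    (fun n => (\int[mu n]_g `|'[c g, xi]|)%:E).
  apply/funext => n; rewrite /Rintegral fineK; last exact: (integrable_fin_num (measurable_discrete _) (int_abs n)).
  by apply: eq_integral => g _; rewrite /c innerZl normrM [in RHS]ger0_norm ?invr_ge0.
by apply/fine_cvgP; split; [exact: nearW|exact: abs0].
Qed.
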